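(* Let $p\ge2$ be an even integer. The equation $$\frac{d\bar\eta}{d\bar u}=\frac1{\bar\eta+\bar u^{p}}$$ has a unique solution $\bar\eta_0(\bar u)$ satisfying $$\bar\eta_0(\bar u)=-\bar u^p-\frac1p\,\frac1{\bar u^{p-1}}+O\Big(\frac1{\bar u^{3p-2}}\Big),\qquad \bar u\to-\infty.$$ Moreover, there exists a constant $K>\frac1p$ such that $$-\bar u^p<\bar\eta_0(\bar u)<-\bar u^p-\frac K{\bar u^{p-1}}\qquad\text{for all }\bar u<0.$$ *)

(* Defs.v *)
From Stdlib Require Import Reals.
From Coquelicot Require Import Coquelicot.
Open Scope R_scope.

(* [eta] solves d(eta)/du = 1 / (eta + u^p) on the open interval (-oo, b).
   The first conjunct is needed because division is total: the right-hand side
   of the equation only makes sense where eta + u^p does not vanish. *)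
Definition solution_on (p : nat) (b : Rbar) (eta : R -> R) : Prop :=
  forall u : R, Rbar_lt u b ->
    eta u + u ^ p <> 0 /\ is_derive eta u (1 / (eta u + u ^ p)).

Definition is_bigO (F : (R -> Prop) -> Prop) (f g : R -> R) : Prop :=
  exists C : R, F (fun u => Rabs (f u) <= C * Rabs (g u)).

Definition has_expansion (p : nat) (eta : R -> R) : Prop :=
  is_bigO (Rbar_locally m_infty)
    (fun u => eta u - (- u ^ p - 1 / INR p * (1 / u ^ (p - 1))))
    (fun u => 1 / u ^ (3 * p - 2)).

(* Main.v *)
Require Import Defs.
From Stdlib Require Import Reals Ranalysis5 Psatz ClassicalEpsilon.
From Coquelicot Require Import Coquelicot.
Open Scope R_scope.

(* Put w = eta + u^p, so that w' = 1/w + p u^(p-1), and let c(u) = -1/(p u^(p-1)) be the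
   zero of the right-hand side for u < 0.  Since 1/w decreases in w, the distance of two
   positive solutions decreases as u grows.  For u < 0, c is a supersolution and
   c - 1/u^(3p-2) a subsolution.  The solutions W_n starting on c at u = -(n+1) are therefore
   trapped between these two barriers and form a Cauchy sequence, uniformly on half-lines;
   their limit is the required solution.  It is global because w stays positive, so b = +oo,
   and K = 1 works because w <= c.  Any other solution with the expansion is positive and
   approaches w as u -> -oo, so by contraction it coincides with w. *)

(** * Comparison principles on an interval *)

(** Let [s] be the last point of [[a, b]] with [0 <= d s]. If [d b < 0], then [s < b] and [d] is
    negative on [(s, b]], so the mean value theorem on [[s, b]] yields [d b >= d s >= 0], a
    contradiction. Asking for the sign of [d'] only where [d < 0] lets sub- and supersolutions be
    compared through the equation itself. *)
Lemma barrier (d d' : R -> R) (a b : R) :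
  a <= b ->
  (forall t, a <= t <= b -> is_derive d t (d' t)) ->
  (forall t, a <= t <= b -> d t < 0 -> 0 <= d' t) ->
  0 <= d a -> 0 <= d b.
Proof.
intros Hab Hd Hpos Ha.
destruct (Rle_lt_dec 0 (d b)) as [H | Hb]; [exact H | exfalso].
destruct (completeness (fun t => a <= t <= b /\ 0 <= d t)) as [s [Hub Hlub]].
{ exists b; intros t [Ht _]; lra. }
{ exists a; split; [lra | exact Ha]. }
assert (Has : a <= s) by (apply Hub; split; [lra | exact Ha]).
assert (Hsb : s <= b) by (apply Hlub; intros t [Ht _]; lra).
(* The supremum is attained: if [d s < 0], then [d] stays negative near [s], and [s - e / 2] would
   be a smaller upper bound. *)
assert (Hs : 0 <= d s).
{ destruct (Rle_lt_dec 0 (d s)) as [H | Hs]; [exact H | exfalso].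
  assert (Hc : continuous d s).
  { apply (ex_derive_continuous (V := R_NormedModule)); exists (d' s); apply Hd; lra. }
  assert (HP : locally s (fun t => d t < 0)).
  { exact (Hc (fun y : R => y < 0) (open_lt 0 (d s) Hs)). }
  destruct HP as [e He].
  assert (s <= s - e / 2); [ | destruct e as [e e0]; simpl in *; lra].
  apply Hlub; intros t [Ht Hdt].
  destruct (Rle_lt_dec t (s - e / 2)) as [H | H]; [exact H | exfalso].
  assert (t <= s) by (apply Hub; split; assumption).
  assert (d t < 0); [ | lra].
  apply He; unfold ball; simpl; unfold AbsRing_ball, abs, minus, plus, opp; simpl.
  destruct e as [e e0]; simpl in *; apply Rabs_def1; lra. }
assert (Hlt : s < b).
{ destruct Hsb as [H | H]; [exact H | subst; lra]. }
destruct (MVT_cor2 d d' s b Hlt) as [c [Hc Hcs]].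
{ intros t Ht; apply is_derive_Reals, Hd; lra. }
assert (Hdc : d c < 0).
{ destruct (Rle_lt_dec 0 (d c)) as [H | H]; [ | exact H].
  assert (c <= s); [apply Hub; split; lra | lra]. }
assert (0 <= d' c * (b - s)); [ | lra].
apply Rmult_le_pos; [apply Hpos; lra | lra].
Qed.

Lemma derive_nonneg_incr (f f' : R -> R) (a b : R) :
  a <= b ->
  (forall t, a <= t <= b -> is_derive f t (f' t)) ->
  (forall t, a <= t <= b -> 0 <= f' t) ->
  f a <= f b.
Proof.
intros Hab Hd Hpos.
enough (0 <= f b - f a) by lra.
apply (barrier (fun t => f t - f a) f' a b Hab); [ | auto | lra].
intros t Ht; rewrite <- (Rminus_0_r (f' t)).
apply (is_derive_minus (V := R_NormedModule)); [auto | apply @is_derive_const].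
Qed.

(** Both [G - f] and [G + f] are nondecreasing. The absolute value on the right covers points on
    either side of [a]. *)
Lemma derive_bound (f f' G G' : R -> R) (a u : R) :
  (forall t, is_derive f t (f' t)) -> (forall t, is_derive G t (G' t)) ->
  (forall t, Rabs (f' t) <= G' t) ->
  Rabs (f u - f a) <= Rabs (G u - G a).
Proof.
intros Hf HG Hle.
assert (Hm : forall x y, x <= y -> Rabs (f y - f x) <= G y - G x).
{ intros x y Hxy.
  assert (G x - f x <= G y - f y).
  { apply (derive_nonneg_incr (fun t => G t - f t) (fun t => G' t - f' t)); auto.
    - intros t _; apply (is_derive_minus (V := R_NormedModule)); auto.
    - intros t _; specialize (Hle t); apply Rabs_le_between in Hle; lra. }
  assert (G x + f x <= G y + f y).
  { apply (derive_nonneg_incr (fun t => G t + f t) (fun t => G' t + f' t)); auto.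
    - intros t _; apply (is_derive_plus (V := R_NormedModule)); auto.
    - intros t _; specialize (Hle t); apply Rabs_le_between in Hle; lra. }
  apply Rabs_le; lra. }
destruct (Rle_lt_dec a u) as [H | H].
- apply Rle_trans with (G u - G a); [auto | apply Rle_abs].
- rewrite (Rabs_minus_sym (f u)), (Rabs_minus_sym (G u)).
  apply Rle_trans with (G a - G u); [apply Hm; lra | apply Rle_abs].
Qed.

(** * Limits with an explicit rate *)

(** The bound [e n] does not depend on [m], so it survives [m -> oo]. The limit is written as
    [real (Lim_seq f)] so that limit functions can be defined pointwise before convergence is
    known. *)
Lemma cauchy_limit_rate (f e : nat -> R) (N : nat) :
  is_lim_seq e 0 ->
  (forall n m, (N <= n <= m)%nat -> Rabs (f m - f n) <= e n) ->
  is_lim_seq f (real (Lim_seq f)) /\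
  forall n, (N <= n)%nat -> Rabs (f n - real (Lim_seq f)) <= e n.
Proof.
intros He Hc.
assert (Hex : ex_finite_lim_seq f).
{ apply ex_lim_seq_cauchy_corr; intros eps.
  apply is_lim_seq_spec in He.
  destruct (He (pos_div_2 eps)) as [N1 HN1].
  exists (Nat.max N N1); intros i j Hi Hj.
  set (M := Nat.max N N1) in *.
  assert (e M < eps / 2).
  { assert (HM : (N1 <= M)%nat) by lia.
    specialize (HN1 M HM); simpl in HN1.
    rewrite Rminus_0_r in HN1; apply Rabs_def2 in HN1; lra. }
  replace (f i - f j) with ((f i - f M) - (f j - f M)) by ring.
  eapply Rle_lt_trans; [apply Rabs_triang | rewrite Rabs_Ropp].
  assert (Rabs (f i - f M) <= e M) by (apply Hc; lia).
  assert (Rabs (f j - f M) <= e M) by (apply Hc; lia).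
  lra. }
assert (Hl := Lim_seq_correct' _ Hex).
split; [exact Hl | intros n Hn].
rewrite Rabs_minus_sym.
apply (is_lim_seq_le_loc (fun m => Rabs (f m - f n)) (fun _ => e n)
  (Rabs (real (Lim_seq f) - f n)) (e n)).
- exists n; intros m Hm; apply Hc; lia.
- apply (is_lim_seq_abs _ (Finite _)).
  apply is_lim_seq_minus'; [exact Hl | apply is_lim_seq_const].
- apply is_lim_seq_const.
Qed.

Lemma CVU_of_bound (f : nat -> R -> R) (g : R -> R) (e : nat -> R) (c : R) (r : posreal) :
  is_lim_seq e 0 ->
  (forall n x, Boule c r x -> Rabs (f n x - g x) <= e n) ->
  CVU f g c r.
Proof.
intros He Hb eps Heps.
apply is_lim_seq_spec in He.
destruct (He (mkposreal eps Heps)) as [N HN].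
exists N; intros n y Hn Hy.
rewrite Rabs_minus_sym.
apply Rle_lt_trans with (e n); [apply Hb; exact Hy | ].
specialize (HN n Hn); simpl in HN.
rewrite Rminus_0_r in HN; apply Rabs_def2 in HN; lra.
Qed.

(** * Picard iteration for [w' = g w + h] with [g] bounded and Lipschitz *)

(** The iteration starts from the integral of the forcing [h] rather than from the constant [c]; the
    first increment is then an integral of [g] alone, controlled by the bound on [g]. *)
Fixpoint picard (g h : R -> R) (a c : R) (n : nat) : R -> R :=
  match n with
  | O => fun u => c + RInt h a u
  | S n => fun u => c + RInt (fun t => g (picard g h a c n t) + h t) a u
  end.

Lemma is_derive_primitive (f : R -> R) (a c u : R) :
  (forall t, continuous f t) -> is_derive (fun u => c + RInt f a u) u (f u).
Proof.
intros Hf.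
rewrite <- (Rplus_0_l (f u)).
apply (is_derive_plus (V := R_NormedModule)); [apply @is_derive_const | ].
apply (is_derive_RInt f (RInt f a) a u); [ | apply Hf].
exists (mkposreal 1 Rlt_0_1); intros y _.
apply (RInt_correct (V := R_CompleteNormedModule)).
apply (ex_RInt_continuous (V := R_CompleteNormedModule)); auto.
Qed.

Lemma lipschitz_continuous (g : R -> R) (L : R) :
  (forall x y, Rabs (g x - g y) <= L * Rabs (x - y)) ->
  forall x, continuous g x.
Proof.
intros HL x.
apply continuity_pt_filterlim.
intros eps Heps.
(* The sign of [L] is not known here, hence [Rabs L + 1] as a positive constant. *)
assert (HL1 : 0 < Rabs L + 1) by (pose proof (Rabs_pos L); lra).
exists (eps / (Rabs L + 1)); split; [apply Rdiv_lt_0_compat; lra | ].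
intros y [_ Hy]; simpl in *; unfold Rdist in *.
eapply Rle_lt_trans; [apply HL | ].
apply Rle_lt_trans with ((Rabs L + 1) * Rabs (y - x)).
- apply Rmult_le_compat_r; [apply Rabs_pos | pose proof (Rle_abs L); lra].
- replace eps with ((Rabs L + 1) * (eps / (Rabs L + 1))) at 1 by (field; lra).
  apply Rmult_lt_compat_l; assumption.
Qed.

(** Induction is needed because the integrand of each iterate is continuous only through the
    differentiability of the previous one. *)
Lemma picard_derive (g h : R -> R) (L a c : R) :
  (forall x y, Rabs (g x - g y) <= L * Rabs (x - y)) ->
  (forall t, continuous h t) ->
  (forall u, is_derive (picard g h a c 0) u (h u)) /\
  forall n u, is_derive (picard g h a c (S n)) u (g (picard g h a c n u) + h u).
Proof.
intros HL Hh.
assert (H0 : forall u, is_derive (picard g h a c 0) u (h u)).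
{ intros u; apply is_derive_primitive, Hh. }
split; [exact H0 | ].
intros n; induction n as [ | n IH]; intros u;
  apply (is_derive_primitive (fun t => g (picard g h a c _ t) + h t));
  intros t; apply (continuous_plus (V := R_NormedModule)); auto;
  apply continuous_comp; try (apply (lipschitz_continuous g L), HL);
  apply @ex_derive_continuous; eexists; [apply H0 | apply IH].
Qed.

(* The even weight E makes the Picard map contract by 1/2 on both sides of a at once. *)
Lemma picard_step (g h : R -> R) (B L a c : R) :
  0 < L -> (forall x, Rabs (g x) <= B) ->
  (forall x y, Rabs (g x - g y) <= L * Rabs (x - y)) ->
  (forall t, continuous h t) ->
  forall n u,
    Rabs (picard g h a c (S n) u - picard g h a c n u)
    <= B / L * (/ 2) ^ n * (exp (2 * L * (u - a)) + exp (- (2 * L * (u - a)))).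
Proof.
intros L0 HB HL Hh.
destruct (picard_derive g h L a c HL Hh) as [D0 DS].
assert (B0 : 0 <= B).
{ eapply Rle_trans; [apply Rabs_pos | apply (HB 0)]. }
set (E u := exp (2 * L * (u - a)) + exp (- (2 * L * (u - a)))).
set (G A u := A / (2 * L) * (exp (2 * L * (u - a)) - exp (- (2 * L * (u - a))))).
assert (HG : forall A u, is_derive (G A) u (A * E u)).
{ intros A u; unfold G, E; auto_derive; [exact I | unfold Rminus; field; lra]. }
assert (HGE : forall A u, 0 <= A -> Rabs (G A u - G A a) <= A / (2 * L) * E u).
{ intros A u HA; unfold G, E.
  replace (2 * L * (a - a)) with 0 by ring.
  rewrite Ropp_0, Rminus_diag, Rmult_0_r, Rminus_0_r, Rabs_mult.
  assert (0 <= A / (2 * L)) by (apply Rdiv_le_0_compat; lra).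
  rewrite (Rabs_pos_eq (A / (2 * L))) by assumption.
  apply Rmult_le_compat_l; [assumption | ].
  pose proof (exp_pos (2 * L * (u - a))); pose proof (exp_pos (- (2 * L * (u - a)))).
  apply Rabs_le; lra. }
assert (HE1 : forall u, 1 <= E u).
{ intros u; unfold E.
  pose proof (exp_ineq1_le (2 * L * (u - a))).
  pose proof (exp_ineq1_le (- (2 * L * (u - a)))). lra. }
assert (Hstart : forall n, picard g h a c n a = c).
{ intros [ | n]; simpl; rewrite RInt_point; apply Rplus_0_r. }
(* Successive iterates agree at [a], so a bound [A * E] on the derivative of their difference
   integrates to [A / (2 * L) * E]; the Lipschitz constant [L] then leaves the factor [1/2]. *)
assert (step : forall n A (d : R -> R), 0 <= A ->
  (forall u, is_derive (fun u => picard g h a c (S n) u - picard g h a c n u) u (d u)) ->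
  (forall u, Rabs (d u) <= A * E u) ->
  forall u, Rabs (picard g h a c (S n) u - picard g h a c n u) <= A / (2 * L) * E u).
{ intros n A d HA Hd Hle u.
  replace (picard g h a c (S n) u - picard g h a c n u) with
    ((picard g h a c (S n) u - picard g h a c n u)
     - (picard g h a c (S n) a - picard g h a c n a)) by (rewrite !Hstart; ring).
  eapply Rle_trans; [ | apply HGE, HA].
  apply (derive_bound (fun u => picard g h a c (S n) u - picard g h a c n u) d
    (G A) (fun u => A * E u)); auto. }
intros n; fold (E); induction n as [ | n IH]; intros u.
(* [A = 2 * B] makes [A / (2 * L)] equal to [B / L]; the bound [B <= 2 * B * E] holds because
   [1 <= E]. *)
- replace (B / L * (/ 2) ^ 0 * _) with (2 * B / (2 * L) * E u)
    by (simpl; unfold E; field; lra).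
  apply (step 0%nat (2 * B) (fun u => g (picard g h a c 0 u) + h u - h u)); [lra | | ].
  + intros v; apply (is_derive_minus (V := R_NormedModule)); [apply DS | apply D0].
  + intros v; replace (g (picard g h a c 0 v) + h v - h v) with (g (picard g h a c 0 v)) by ring.
    eapply Rle_trans; [apply HB | ]. specialize (HE1 v); nra.
- replace (B / L * (/ 2) ^ S n * _) with (L * (B / L * (/ 2) ^ n) / (2 * L) * E u)
    by (simpl; unfold E; field; lra).
  apply (step (S n) (L * (B / L * (/ 2) ^ n))
    (fun u => g (picard g h a c (S n) u) + h u - (g (picard g h a c n u) + h u))).
  + repeat apply Rmult_le_pos; try lra.
    * left; apply Rinv_0_lt_compat; exact L0.
    * apply pow_le; lra.
  + intros v; apply (is_derive_minus (V := R_NormedModule)); apply DS.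
  + intros v.
    replace (g (picard g h a c (S n) v) + h v - (g (picard g h a c n v) + h v))
      with (g (picard g h a c (S n) v) - g (picard g h a c n v)) by ring.
    eapply Rle_trans; [apply HL | ].
    rewrite Rmult_assoc; apply Rmult_le_compat_l; [lra | apply IH].
Qed.

(** Within distance [r] of [a] the weight is at most [2 * exp (2 * L * r)], and the increments sum
    as a geometric series. *)
Lemma picard_cauchy (g h : R -> R) (B L a c r : R) :
  0 < L -> (forall x, Rabs (g x) <= B) ->
  (forall x y, Rabs (g x - g y) <= L * Rabs (x - y)) ->
  (forall t, continuous h t) ->
  forall n m u, Rabs (u - a) < r -> (n <= m)%nat ->
    Rabs (picard g h a c m u - picard g h a c n u)
    <= 4 * (B / L) * exp (2 * L * r) * (/ 2) ^ n.
Proof.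
intros L0 HB HL Hh n m u Hu Hnm.
assert (B0 : 0 <= B / L).
{ apply Rdiv_le_0_compat; [ | exact L0]. eapply Rle_trans; [apply Rabs_pos | apply (HB 0)]. }
set (M := 2 * (B / L) * exp (2 * L * r)).
assert (HM : 0 <= M).
{ unfold M; pose proof (exp_pos (2 * L * r)); apply Rmult_le_pos; lra. }
assert (Hs : forall i, Rabs (picard g h a c (S i) u - picard g h a c i u) <= M * (/ 2) ^ i).
{ intros i; eapply Rle_trans; [apply (picard_step g h B L a c L0 HB HL Hh) | ].
  replace (M * (/ 2) ^ i) with (B / L * (/ 2) ^ i * (2 * exp (2 * L * r)))
    by (unfold M; ring).
  apply Rmult_le_compat_l; [apply Rmult_le_pos; [lra | apply pow_le; lra] | ].
  apply Rabs_def2 in Hu.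
  assert (exp (2 * L * (u - a)) <= exp (2 * L * r)) by (left; apply exp_increasing; nra).
  assert (exp (- (2 * L * (u - a))) <= exp (2 * L * r)) by (left; apply exp_increasing; nra).
  lra. }
(* Keeping the subtracted tail [2 * M * (/ 2) ^ m] makes the induction on [m] close exactly. *)
assert (Hsum : Rabs (picard g h a c m u - picard g h a c n u)
               <= 2 * M * (/ 2) ^ n - 2 * M * (/ 2) ^ m).
{ induction Hnm as [ | m Hnm IH].
  - rewrite !Rminus_diag, Rabs_R0; lra.
  - replace (picard g h a c (S m) u - picard g h a c n u) with
      ((picard g h a c (S m) u - picard g h a c m u)
       + (picard g h a c m u - picard g h a c n u)) by ring.
    eapply Rle_trans; [apply Rabs_triang | ].
    specialize (Hs m); simpl pow; lra. }
assert (0 <= 2 * M * (/ 2) ^ m).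
{ apply Rmult_le_pos; [lra | apply pow_le; lra]. }
replace (4 * (B / L) * exp (2 * L * r) * (/ 2) ^ n) with (2 * M * (/ 2) ^ n)
  by (unfold M; ring).
lra.
Qed.

(** The iterates converge uniformly on every ball around [a], so the solution exists on the whole
    line and not just locally. *)
Lemma picard_lindelof (g h : R -> R) (B L a c : R) :
  0 < L -> (forall x, Rabs (g x) <= B) ->
  (forall x y, Rabs (g x - g y) <= L * Rabs (x - y)) ->
  (forall t, continuous h t) ->
  exists w : R -> R, w a = c /\ forall u, is_derive w u (g (w u) + h u).
Proof.
intros L0 HB HL Hh.
set (phi := picard g h a c).
set (w u := real (Lim_seq (fun n => phi n u))).
set (e r n := 4 * (B / L) * exp (2 * L * r) * (/ 2) ^ n).
assert (He : forall r, is_lim_seq (e r) 0).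
{ intros r; unfold e; evar_last.
  - apply is_lim_seq_scal_l, is_lim_seq_geom; rewrite Rabs_pos_eq; lra.
  - simpl; f_equal; ring. }
assert (Hw : forall r n u, Rabs (u - a) < r ->
  is_lim_seq (fun m => phi m u) (w u) /\ Rabs (phi n u - w u) <= e r n).
{ intros r n u Hu.
  destruct (cauchy_limit_rate (fun m => phi m u) (e r) 0 (He r)) as [H1 H2].
  - intros i j Hij; apply picard_cauchy; [assumption.. | apply Hij].
  - split; [exact H1 | apply H2; lia]. }
destruct (picard_derive g h L a c HL Hh) as [D0 DS]; fold phi in D0, DS.
assert (Hg := lipschitz_continuous g L HL).
exists w; split.
- assert (Hphi : forall n, phi n a = c).
  { intros [ | n]; unfold phi; simpl; rewrite RInt_point; apply Rplus_0_r. }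
  unfold w; rewrite (Lim_seq_ext _ (fun _ => c)) by exact Hphi.
  rewrite Lim_seq_const; reflexivity.
- intros u.
  assert (r0 : 0 < Rabs (u - a) + 1) by (pose proof (Rabs_pos (u - a)); lra).
  set (r := mkposreal _ r0).
  assert (Hcw : forall y, Boule a r y -> continuity_pt w y).
  { apply (CVU_continuity phi w a r).
    - apply (CVU_of_bound _ _ (e r)); [apply He | ].
      intros n y Hy; apply Hw, Hy.
    - intros n y _; apply continuity_pt_filterlim, (@ex_derive_continuous _ R_NormedModule).
      destruct n; eexists; [apply D0 | apply DS]. }
  apply is_derive_Reals.
  (* The sequence is shifted by one, since the derivative of [phi (S n)] is expressed through
     [phi n]. *)
  apply (derivable_pt_lim_CVU (fun n => phi (S n)) (fun n y => g (phi n y) + h y) w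
    (fun y => g (w y) + h y) u a r).
  + unfold Boule; simpl; lra.
  + intros y n _; apply is_derive_Reals, DS.
  + intros y Hy; apply is_lim_seq_Reals, is_lim_seq_incr_1 with (u := fun n => phi n y).
    apply (Hw r 0%nat), Hy.
  + apply (CVU_of_bound _ _ (fun n => L * e r n)).
    * evar_last; [apply is_lim_seq_scal_l, He | simpl; f_equal; ring].
    * intros n y Hy.
      replace (g (phi n y) + h y - (g (w y) + h y)) with (g (phi n y) - g (w y)) by ring.
      eapply Rle_trans; [apply HL | ].
      apply Rmult_le_compat_l; [lra | apply Hw, Hy].
  + intros y Hy; apply continuity_pt_filterlim.
    apply (continuous_plus (V := R_NormedModule) (fun y => g (w y)) h); [ | apply Hh].
    apply (continuous_comp w g); [apply continuity_pt_filterlim, Hcw, Hy | apply Hg].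
Qed.

(** * The equation for [w], and the signs, derivatives and sizes of the two barriers *)

(* Throughout, p = 2 k + 2, hence p - 1 = 2 k + 1 and 3 p - 2 = 6 k + 4. *)
Definition trajectory (k : nat) (w : R -> R) (u : R) : Prop :=
  0 < w u /\ is_derive w u (/ w u + INR (2 * k + 2) * u ^ (2 * k + 1)).

Definition critical (k : nat) (u : R) : R := - / (INR (2 * k + 2) * u ^ (2 * k + 1)).

Definition lower (k : nat) (u : R) : R := critical k u - / u ^ (6 * k + 4).

(** Both denominators are at least [d], and [Rmax] with [d] is 1-Lipschitz. It serves the capped
    equation as well as the convergence of [1/W_n]. *)
Lemma Rinv_Rmax_lipschitz (d x y : R) :
  0 < d -> Rabs (/ Rmax x d - / Rmax y d) <= / d ^ 2 * Rabs (x - y).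
Proof.
intros d0.
pose proof (Rmax_r x d) as Hx; pose proof (Rmax_r y d) as Hy.
replace (/ Rmax x d - / Rmax y d) with (/ (Rmax x d * Rmax y d) * (Rmax y d - Rmax x d))
  by (field; lra).
rewrite Rabs_mult; apply Rmult_le_compat; try apply Rabs_pos.
- rewrite Rabs_pos_eq by (left; apply Rinv_0_lt_compat; nra).
  apply Rinv_le_contravar; nra.
- unfold Rmax; destruct (Rle_dec x d), (Rle_dec y d);
    unfold Rabs; destruct (Rcase_abs _), (Rcase_abs _); lra.
Qed.

Lemma pow_even_nonneg (k : nat) (x : R) : 0 <= x ^ (2 * k).
Proof. rewrite pow_mult; apply pow_le, pow2_ge_0. Qed.

Lemma pow_even_pos (k : nat) (x : R) : x <> 0 -> 0 < x ^ (2 * k).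
Proof. intros Hx; rewrite pow_mult; apply pow_lt, pow2_gt_0, Hx. Qed.

Lemma pow_odd_neg (k : nat) (x : R) : x < 0 -> x ^ (2 * k + 1) < 0.
Proof.
intros Hx; rewrite pow_add, pow_1.
pose proof (pow_even_pos k x); nra.
Qed.

Lemma pow_odd_incr (k : nat) (x y : R) : x <= y -> x ^ (2 * k + 1) <= y ^ (2 * k + 1).
Proof.
intros Hxy.
apply (derive_nonneg_incr (fun t => t ^ (2 * k + 1)) (fun t => INR (2 * k + 1) * t ^ (2 * k)));
  [exact Hxy | | ].
- intros t _; auto_derive; [exact I | ].
  change (k + (k + 0))%nat with (2 * k)%nat.
  replace (pred (2 * k + 1)) with (2 * k)%nat by lia; ring.
- intros t _; apply Rmult_le_pos; [apply pos_INR | apply pow_even_nonneg].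
Qed.

Lemma critical_pos (k : nat) (u : R) : u < 0 -> 0 < critical k u.
Proof.
intros Hu; unfold critical; rewrite <- Rinv_opp; apply Rinv_0_lt_compat.
pose proof (pow_odd_neg k u Hu).
assert (0 < INR (2 * k + 2)) by (apply lt_0_INR; lia).
nra.
Qed.

Lemma inv_critical (k : nat) (u : R) : / critical k u = - (INR (2 * k + 2) * u ^ (2 * k + 1)).
Proof. unfold critical; rewrite Rinv_opp, Rinv_inv; reflexivity. Qed.

(** All powers are expressed through [u ^ (2 * k)], whose sign is known, so that [field] can treat
    it as an atom. *)
Lemma pow_split (k : nat) (u : R) :
  u ^ (2 * k + 1) = u ^ (2 * k) * u /\ u ^ (2 * k + 2) = u ^ (2 * k) * u ^ 2 /\
  u ^ (6 * k + 4) = (u ^ (2 * k)) ^ 3 * u ^ 4 /\ u ^ (6 * k + 5) = (u ^ (2 * k)) ^ 3 * u ^ 5.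
Proof.
repeat split; rewrite pow_add; f_equal; try apply pow_1;
  rewrite <- pow_mult; f_equal; lia.
Qed.

Lemma is_derive_critical (k : nat) (u : R) :
  u < 0 ->
  is_derive (critical k) u (INR (2 * k + 1) / INR (2 * k + 2) / u ^ (2 * k + 2)).
Proof.
intros Hu; unfold critical.
assert (HN : INR (2 * k + 2) <> 0) by (apply not_0_INR; lia).
destruct (pow_split k u) as (E1 & E2 & _).
pose proof (pow_even_pos k u).
pose proof (pow_odd_neg k u Hu).
auto_derive; change (k + (k + 0))%nat with (2 * k)%nat.
{ apply Rmult_integral_contrapositive; split; lra. }
replace (pred (2 * k + 1)) with (2 * k)%nat by lia.
rewrite E1, E2; field; repeat split; lra.
Qed.

Lemma is_derive_lower (k : nat) (u : R) :
  u < 0 ->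
  is_derive (lower k) u
    (INR (2 * k + 1) / INR (2 * k + 2) / u ^ (2 * k + 2) + INR (6 * k + 4) / u ^ (6 * k + 5)).
Proof.
intros Hu.
destruct (pow_split k u) as (_ & _ & E3 & E4).
pose proof (pow_even_pos k u).
unfold lower.
replace (_ + _) with
  (minus (INR (2 * k + 1) / INR (2 * k + 2) / u ^ (2 * k + 2)) (- INR (6 * k + 4) / u ^ (6 * k + 5)))
  by (unfold minus, plus, opp; simpl; unfold Rdiv; ring).
apply (is_derive_minus (V := R_NormedModule)); [apply is_derive_critical, Hu | ].
auto_derive; change (k + (k + (k + (k + (k + (k + 0))))))%nat with (6 * k)%nat.
- rewrite E3; apply Rmult_integral_contrapositive; split; apply pow_nonzero; lra.
- replace (pred (6 * k + 4)) with (6 * k + 3)%nat by lia.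
  assert (E5 : u ^ (6 * k + 3) = (u ^ (2 * k)) ^ 3 * u ^ 3).
  { rewrite pow_add, <- pow_mult; f_equal; f_equal; lia. }
  rewrite E3, E4, E5; field; lra.
Qed.

(** The lower bound makes [critical] a supersolution; the upper one is what [lower] must beat to be
    a subsolution. *)
Lemma critical_derive_bounds (k : nat) (u : R) :
  u < 0 -> 0 <= INR (2 * k + 1) / INR (2 * k + 2) / u ^ (2 * k + 2) <= / u ^ (2 * k + 2).
Proof.
intros Hu.
assert (0 < u ^ (2 * k + 2)).
{ replace (2 * k + 2)%nat with (2 * (k + 1))%nat by lia; apply pow_even_pos; lra. }
assert (0 < / u ^ (2 * k + 2)) by (apply Rinv_0_lt_compat; assumption).
assert (0 <= INR (2 * k + 1)) by apply pos_INR.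
assert (INR (2 * k + 1) <= INR (2 * k + 2)) by (apply le_INR; lia).
assert (0 < INR (2 * k + 2)) by (apply lt_0_INR; lia).
assert (0 <= INR (2 * k + 1) / INR (2 * k + 2) <= 1).
{ split; [apply Rdiv_le_0_compat; assumption | ].
  apply Rle_div_l; lra. }
unfold Rdiv in *; nra.
Qed.

(** This gives the Cauchy rate [1/(n+1)] for trajectories started at [-(n+1)]. *)
Lemma critical_le_inv (k : nat) (u : R) : 1 <= - u -> critical k u <= / - u.
Proof.
intros Hu; unfold critical; rewrite <- Rinv_opp.
apply Rinv_le_contravar; [lra | ].
rewrite (proj1 (pow_split k u)), pow_mult.
assert (1 <= (u ^ 2) ^ k) by (apply pow_R1_Rle; nra).
assert (1 <= INR (2 * k + 2)) by (apply (le_INR 1); lia).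
replace (- (INR (2 * k + 2) * ((u ^ 2) ^ k * u))) with ((INR (2 * k + 2) * (u ^ 2) ^ k) * - u) by ring.
assert (1 <= INR (2 * k + 2) * (u ^ 2) ^ k) by nra.
nra.
Qed.

Lemma pow_6k4_pos (k : nat) (u : R) : u <> 0 -> 0 < u ^ (6 * k + 4).
Proof.
intros Hu; replace (6 * k + 4)%nat with (2 * (3 * k + 2))%nat by lia.
apply pow_even_pos, Hu.
Qed.

(** With [N = INR (2 * k + 2)], [P = u ^ (2 * k)] and [s = - P * u >= 1], the ratio of the two sides
    is [C * N * s / (P ^ 3 * u ^ 4)], and [C * N < - u] bounds it by [1 / s ^ 2]. It shows that
    whatever is [C / u ^ (6 * k + 4)]-close to [critical] is positive far to the left. *)
Lemma correction_lt_critical (k : nat) (C u : R) :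
  1 <= - u -> C * INR (2 * k + 2) < - u -> C * / u ^ (6 * k + 4) < critical k u.
Proof.
intros Hu HC.
assert (HN : 0 < INR (2 * k + 2)) by (apply lt_0_INR; lia).
destruct (pow_split k u) as (E1 & _ & E3 & _).
assert (HP : 1 <= u ^ (2 * k)) by (rewrite pow_mult; apply pow_R1_Rle; nra).
set (P := u ^ (2 * k)) in *.
assert (Hc : critical k u = / (INR (2 * k + 2) * P * - u)).
{ unfold critical; rewrite E1, <- Rinv_opp; f_equal; ring. }
rewrite Hc, E3.
assert (HD : 0 < INR (2 * k + 2) * P * - u) by (apply Rmult_lt_0_compat; [nra | lra]).
assert (HQ : 0 < P ^ 3 * u ^ 4).
{ apply Rmult_lt_0_compat; [apply pow_lt; lra | apply (pow_even_pos 2); lra]. }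
apply (Rmult_lt_reg_r (INR (2 * k + 2) * P * - u)); [exact HD | ].
rewrite Rinv_l by lra.
apply (Rmult_lt_reg_r (P ^ 3 * u ^ 4)); [exact HQ | ].
replace (C * / (P ^ 3 * u ^ 4) * (INR (2 * k + 2) * P * - u) * (P ^ 3 * u ^ 4))
  with ((C * INR (2 * k + 2)) * (P * - u)) by (field; lra).
replace (1 * (P ^ 3 * u ^ 4)) with ((- u * (P * - u)) * (P * - u) ^ 2) by ring.
assert (Hs : 1 <= P * - u) by nra.
set (s := P * - u) in *.
assert (C * INR (2 * k + 2) * s < - u * s) by (apply Rmult_lt_compat_r; lra).
assert (0 < - u * s) by (apply Rmult_lt_0_compat; lra).
assert (1 <= s ^ 2) by (apply pow_R1_Rle; exact Hs).
nra.
Qed.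

(** * Trapping and contraction of trajectories *)

(** From [d <= critical k a] one gets [/ d >= - INR (2 * k + 2) * a ^ (2 * k + 1)], and the odd
    power increases, so [w' >= 0] wherever [w < d], even for positive times. Leaving [w'] abstract
    covers both the true equation and the one with [1/w] capped. *)
Lemma const_subsolution (k : nat) (w w' : R -> R) (a d u : R) :
  a < 0 -> 0 < d <= critical k a -> a <= u ->
  (forall t, a <= t -> is_derive w t (w' t)) ->
  (forall t, a <= t -> w t < d -> / d + INR (2 * k + 2) * t ^ (2 * k + 1) <= w' t) ->
  d <= w a -> d <= w u.
Proof.
intros Ha [d0 Hd] Hu Hw Hw' Hwa.
enough (0 <= w u - d) by lra.
apply (barrier (fun t => w t - d) w' a u); [exact Hu | | | lra].
- intros t Ht; rewrite <- (Rminus_0_r (w' t)).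
  apply (is_derive_minus (V := R_NormedModule)); [apply Hw; lra | apply @is_derive_const].
- intros t Ht Hlt.
  eapply Rle_trans; [ | apply Hw'; lra].
  assert (/ critical k a <= / d) by (apply Rinv_le_contravar; assumption).
  rewrite inv_critical in H.
  pose proof (pow_odd_incr k a t (proj1 Ht)).
  assert (0 < INR (2 * k + 2)) by (apply lt_0_INR; lia).
  nra.
Qed.

Lemma trajectory_ge_const (k : nat) (w : R -> R) (a d u : R) :
  a < 0 -> 0 < d <= critical k a -> a <= u ->
  (forall t, a <= t -> trajectory k w t) ->
  d <= w a -> d <= w u.
Proof.
intros Ha Hd Hu Hw; apply (const_subsolution k w
  (fun t => / w t + INR (2 * k + 2) * t ^ (2 * k + 1)) a d u Ha Hd Hu).
- intros t Ht; apply Hw, Ht.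
- intros t Ht Hlt; apply Rplus_le_compat_r, Rinv_le_contravar; [apply Hw, Ht | lra].
Qed.

Lemma trajectory_from_critical (k : nat) (a : R) :
  a < 0 ->
  exists w : R -> R, w a = critical k a /\ forall u, a <= u -> trajectory k w u.
Proof.
intros Ha.
pose proof (critical_pos k a Ha) as d0; set (d := critical k a) in *.
(* Capping 1/w below height d makes it Lipschitz; w never drops below d, so the cap is inactive. *)
destruct (picard_lindelof (fun x => / Rmax x d)
  (fun u => INR (2 * k + 2) * u ^ (2 * k + 1)) (/ d) (/ d ^ 2) a d) as [w [Hwa Hw]].
- apply Rinv_0_lt_compat; nra.
- intros x; pose proof (Rmax_r x d).
  rewrite Rabs_pos_eq by (left; apply Rinv_0_lt_compat; lra).
  apply Rinv_le_contravar; assumption.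
- intros x y; apply Rinv_Rmax_lipschitz, d0.
- intros t; apply (ex_derive_continuous (V := R_NormedModule)); auto_derive; exact I.
- exists w; split; [exact Hwa | intros u Hu].
  assert (Hd : forall t, a <= t -> d <= w t).
  { intros t Ht; apply (const_subsolution k w
      (fun t => / Rmax (w t) d + INR (2 * k + 2) * t ^ (2 * k + 1)) a d t
      Ha (conj d0 (Rle_refl _)) Ht).
    - intros s _; apply Hw.
    - intros s _ Hs; rewrite Rmax_right by lra; apply Rle_refl.
    - lra. }
  specialize (Hw u); rewrite Rmax_left in Hw by (apply Hd, Hu).
  split; [specialize (Hd u Hu); lra | exact Hw].
Qed.

(** Where [w] exceeds [critical], the right-hand side is at most zero, while [critical] is
    nondecreasing. *)
Lemma trajectory_le_critical (k : nat) (w : R -> R) (a u : R) :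
  a <= u < 0 -> (forall t, a <= t -> trajectory k w t) ->
  w a <= critical k a -> w u <= critical k u.
Proof.
intros Hu Hw Ha.
enough (0 <= critical k u - w u) by lra.
apply (barrier (fun t => critical k t - w t) (fun t =>
  INR (2 * k + 1) / INR (2 * k + 2) / t ^ (2 * k + 2)
  - (/ w t + INR (2 * k + 2) * t ^ (2 * k + 1))) a u); [lra | | | lra].
- intros t Ht; apply (is_derive_minus (V := R_NormedModule)).
  + apply is_derive_critical; lra.
  + apply Hw; lra.
- intros t Ht Hlt.
  assert (t0 : t < 0) by lra.
  assert (/ w t <= / critical k t).
  { apply Rinv_le_contravar; [apply critical_pos, t0 | lra]. }
  rewrite inv_critical in H.
  pose proof (critical_derive_bounds k t t0); lra.
Qed.

(** Write [c] for [critical] and [e = / t ^ (6 * k + 4)]. Where [w < c - e], one has [w' = 1/w - 1/c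
    >= e / c ^ 2 >= / t ^ (2 * k + 2) >= c'], and the derivative of [lower] is at most [c']. The
    exponent [6 * k + 4] is the one that puts [e / c ^ 2] at the order of [c']. *)
Lemma trajectory_ge_lower (k : nat) (w : R -> R) (a u : R) :
  a <= u < 0 -> (forall t, a <= t -> trajectory k w t) ->
  lower k a <= w a -> lower k u <= w u.
Proof.
intros Hu Hw Ha.
enough (0 <= w u - lower k u) by lra.
apply (barrier (fun t => w t - lower k t) (fun t =>
  (/ w t + INR (2 * k + 2) * t ^ (2 * k + 1)) -
  (INR (2 * k + 1) / INR (2 * k + 2) / t ^ (2 * k + 2) + INR (6 * k + 4) / t ^ (6 * k + 5))) a u);
  [lra | | | lra].
- intros t Ht; apply (is_derive_minus (V := R_NormedModule)).
  + apply Hw; lra.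
  + apply is_derive_lower; lra.
- intros t Ht Hlt.
  assert (t0 : t < 0) by lra.
  destruct (Hw t (proj1 Ht)) as [w0 _].
  pose proof (critical_pos k t t0) as c0.
  pose proof (pow_6k4_pos k t ltac:(lra)) as e0.
  apply Rinv_0_lt_compat in e0.
  assert (H1 : INR (6 * k + 4) / t ^ (6 * k + 5) <= 0).
  { replace (6 * k + 5)%nat with (2 * (3 * k + 2) + 1)%nat by lia.
    pose proof (pow_odd_neg (3 * k + 2) t t0) as Hn.
    apply Rinv_lt_0_compat in Hn.
    pose proof (pos_INR (6 * k + 4)); unfold Rdiv; nra. }
  pose proof (critical_derive_bounds k t t0) as [_ H2].
  replace (INR (2 * k + 2) * t ^ (2 * k + 1)) with (- / critical k t)
    by (rewrite inv_critical; ring).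
  (* After multiplication by [w t] and use of [w t < c - e], this is [1 - (e / c) ^ 2 <= 1]. *)
  assert (H3 : / critical k t + / t ^ (6 * k + 4) * (/ critical k t) ^ 2 <= / w t).
  { assert (Hwl : w t < critical k t - / t ^ (6 * k + 4)) by (unfold lower in Hlt; lra).
    set (c := critical k t) in *; set (e := / t ^ (6 * k + 4)) in *.
    apply (Rmult_le_reg_r (w t)); [exact w0 | rewrite Rinv_l by lra].
    apply Rle_trans with ((/ c + e * / c ^ 2) * (c - e)).
    - rewrite pow_inv; apply Rmult_le_compat_l; [ | lra].
      apply Rlt_le, Rplus_lt_0_compat; [apply Rinv_0_lt_compat, c0 | ].
      apply Rmult_lt_0_compat; [exact e0 | apply Rinv_0_lt_compat; nra].
    - replace ((/ c + e * / c ^ 2) * (c - e)) with (1 - (e * / c) ^ 2) by (field; lra).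
      pose proof (pow2_ge_0 (e * / c)); lra. }
  assert (H4 : / t ^ (2 * k + 2) <= / t ^ (6 * k + 4) * (/ critical k t) ^ 2).
  { rewrite inv_critical.
    destruct (pow_split k t) as (E1 & E2 & E3 & _).
    pose proof (pow_even_pos k t ltac:(lra)) as HP.
    rewrite E1, E2, E3.
    replace (_ * (- _) ^ 2) with (INR (2 * k + 2) ^ 2 * / (t ^ (2 * k) * t ^ 2)) by (field; lra).
    assert (1 <= INR (2 * k + 2)) by (apply (le_INR 1); lia).
    assert (0 < / (t ^ (2 * k) * t ^ 2)).
    { apply Rinv_0_lt_compat, Rmult_lt_0_compat; [exact HP | apply pow2_gt_0; lra]. }
    rewrite <- (Rmult_1_l (/ _)) at 1.
    apply Rmult_le_compat_r; [lra | apply pow_R1_Rle; assumption]. }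
  lra.
Qed.

(** The forcing cancels in the difference, and [(w1 - w2) ^ 2] has derivative
    [- 2 * (w1 - w2) ^ 2 / (w1 * w2) <= 0]. *)
Lemma trajectory_contraction (k : nat) (w1 w2 : R -> R) (a u : R) :
  a <= u ->
  (forall t, a <= t <= u -> trajectory k w1 t) ->
  (forall t, a <= t <= u -> trajectory k w2 t) ->
  Rabs (w1 u - w2 u) <= Rabs (w1 a - w2 a).
Proof.
intros Hu H1 H2.
apply Rsqr_le_abs_0; unfold Rsqr.
enough (- ((w1 a - w2 a) * (w1 a - w2 a)) <= - ((w1 u - w2 u) * (w1 u - w2 u))) by lra.
apply (derive_nonneg_incr (fun t => - ((w1 t - w2 t) * (w1 t - w2 t)))
  (fun t => 2 * (w1 t - w2 t) ^ 2 * / (w1 t * w2 t))); [exact Hu | | ].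
- intros t Ht; destruct (H1 t Ht) as [p1 D1], (H2 t Ht) as [p2 D2].
  evar_last.
  + apply @is_derive_opp, @is_derive_mult; [apply @is_derive_minus; eassumption.. | ].
    intros; apply Rmult_comm.
  + unfold plus, mult, minus, opp; simpl; unfold plus, opp; simpl; field; lra.
- intros t Ht; destruct (H1 t Ht) as [p1 _], (H2 t Ht) as [p2 _].
  apply Rmult_le_pos; [ | left; apply Rinv_0_lt_compat; nra].
  pose proof (pow2_ge_0 (w1 t - w2 t)); lra.
Qed.

(** * Construction of the trapped global trajectory *)

Lemma is_lim_seq_inv_succ : is_lim_seq (fun n => / (INR n + 1)) 0.
Proof.
apply is_lim_seq_ext with (fun n => / INR (S n)).
{ intros n; rewrite S_INR; reflexivity. }
apply (is_lim_seq_incr_1 (fun n => / INR n)).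
apply (is_lim_seq_inv _ p_infty); [apply is_lim_seq_INR | discriminate].
Qed.

Lemma trajectory_continuity (k : nat) (w : R -> R) (u : R) :
  trajectory k w u -> continuity_pt w u.
Proof.
intros [_ H]; apply continuity_pt_filterlim, (ex_derive_continuous (V := R_NormedModule)).
eexists; exact H.
Qed.

Lemma slow_trajectory (k : nat) :
  exists w : R -> R,
    (forall u, trajectory k w u) /\
    forall u, u < 0 -> lower k u <= w u <= critical k u.
Proof.
set (a n := - (INR n + 1)).
assert (a0 : forall n, a n <= -1) by (intros n; unfold a; pose proof (pos_INR n); lra).
assert (Hex : forall n, exists w : R -> R,
  w (a n) = critical k (a n) /\ forall u, a n <= u -> trajectory k w u).
{ intros n; apply trajectory_from_critical; specialize (a0 n); lra. }
set (W n := proj1_sig (constructive_indefinite_description _ (Hex n))).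
assert (HW : forall n, W n (a n) = critical k (a n) /\
  forall u, a n <= u -> trajectory k (W n) u).
{ intros n; unfold W; destruct (constructive_indefinite_description _ (Hex n)); assumption. }
assert (amono : forall n m, (n <= m)%nat -> a m <= a n).
{ intros n m Hnm; unfold a; apply le_INR in Hnm; lra. }
assert (HWle : forall n u, a n <= u < 0 -> W n u <= critical k u).
{ intros n u Hu; destruct (HW n) as [E T].
  apply (trajectory_le_critical k (W n) (a n) u Hu T); lra. }
assert (HWge : forall n u, a n <= u < 0 -> lower k u <= W n u).
{ intros n u Hu; destruct (HW n) as [E T].
  apply (trajectory_ge_lower k (W n) (a n) u Hu T); rewrite E; unfold lower.
  pose proof (pow_6k4_pos k (a n) ltac:(specialize (a0 n); lra)) as Hp.
  apply Rinv_0_lt_compat in Hp; lra. }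
set (e n := / (INR n + 1)).
assert (He : is_lim_seq e 0) by apply is_lim_seq_inv_succ.
(* At [a n] both trajectories lie between 0 and [critical k (a n) <= 1/(n+1)]; contraction carries
   this bound to all later [u]. *)
assert (HC : forall n m u, a n <= u -> (n <= m)%nat -> Rabs (W m u - W n u) <= e n).
{ intros n m u Hu Hnm.
  specialize (amono n m Hnm).
  assert (an : a n < 0) by (specialize (a0 n); lra).
  eapply Rle_trans.
  - apply (trajectory_contraction k (W m) (W n) (a n) u Hu);
      intros t Ht; apply HW; lra.
  - apply Rle_trans with (critical k (a n)).
    + pose proof (HWle m (a n) ltac:(lra)).
      pose proof (HWle n (a n) ltac:(lra)).
      destruct (proj2 (HW m) (a n) amono) as [p1 _].
      destruct (proj2 (HW n) (a n) (Rle_refl _)) as [p2 _].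
      apply Rabs_le; lra.
    + replace (e n) with (/ - a n) by (unfold e, a; f_equal; ring).
      apply critical_le_inv; specialize (a0 n); lra. }
(* For fixed [u] the terms with [a n > u] carry no information, but there are finitely many of
   them. *)
set (w u := real (Lim_seq (fun n => W n u))).
assert (Hlim : forall N u, a N <= u ->
  is_lim_seq (fun n => W n u) (w u) /\
  forall n, (N <= n)%nat -> Rabs (W n u - w u) <= e n).
{ intros N u Hu.
  apply (cauchy_limit_rate (fun n => W n u) e N He).
  intros n m [Hn Hm]; apply HC; [ | exact Hm].
  specialize (amono N n Hn); lra. }
(* Requiring [2 * k + 2 <= N] makes [- a N] exceed [INR (2 * k + 2)], hence [lower k (a N)]
   positive. *)
assert (Ha : forall u, exists N, (2 * k + 2 <= N)%nat /\ a N < u).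
{ intros u; destruct (INR_archimed 1 (Rabs u) Rlt_0_1) as [N HN].
  exists (2 * k + 2 + N)%nat; split; [lia | ].
  unfold a; rewrite plus_INR; pose proof (pos_INR (2 * k + 2)).
  pose proof (Rle_abs (- u)); rewrite Rabs_Ropp in *; lra. }
exists w; split.
- intros u; destruct (Ha u) as [N [HkN HaN]].
  pose proof (a0 N) as aN.
  (* This [d] bounds [w] and every [W n] with [n >= N] from below on [[a N, oo)]; there the inverse
     is Lipschitz, so the derivatives converge uniformly too. *)
  set (d := lower k (a N)).
  assert (d0 : 0 < d).
  { pose proof (correction_lt_critical k 1 (a N) ltac:(lra)) as H.
    unfold d, lower; rewrite Rmult_1_l, Rmult_1_l in H.
    enough (INR (2 * k + 2) < - a N) by (specialize (H H0); lra).
    unfold a; apply le_INR in HkN; lra. }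
  assert (Hd : forall n y, (N <= n)%nat -> a N <= y -> d <= W n y).
  { intros n y Hn Hy; specialize (amono N n Hn).
    apply (trajectory_ge_const k (W n) (a N) d y ltac:(lra)); [ | exact Hy | | ].
    - split; [exact d0 | ].
      apply Rle_trans with (W N (a N)); [apply HWge | apply HWle]; lra.
    - intros t Ht; apply HW; lra.
    - apply HWge; lra. }
  assert (Hwd : forall y, a N <= y -> d <= w y).
  { intros y Hy; destruct (Hlim N y Hy) as [Hl _].
    apply (is_lim_seq_le_loc (fun _ => d) (fun n => W n y) d (w y));
      [ | apply is_lim_seq_const | exact Hl].
    exists N; intros n Hn; apply Hd; assumption. }
  split; [specialize (Hwd u); lra | ].
  assert (r0 : 0 < u - a N) by lra.
  set (r := mkposreal _ r0).
  assert (HB : forall y, Boule u r y -> a N <= y).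
  { intros y Hy; unfold Boule in Hy; simpl in Hy; apply Rabs_def2 in Hy; lra. }
  (* Dropping the first [N] terms leaves functions that are all trajectories on the ball around
     [u]. *)
  set (V n := W (n + N)%nat).
  assert (HeN : is_lim_seq (fun n => e (n + N)%nat) 0).
  { apply (is_lim_seq_incr_n e N), He. }
  assert (HV : forall n y, Boule u r y -> trajectory k (V n) y).
  { intros n y Hy; apply HW; specialize (HB y Hy); specialize (amono N (n + N)%nat ltac:(lia)); lra. }
  assert (HVw : forall n y, Boule u r y -> Rabs (V n y - w y) <= e (n + N)%nat).
  { intros n y Hy; apply (Hlim N y (HB y Hy)); lia. }
  assert (Hcw : forall y, Boule u r y -> continuity_pt w y).
  { apply (CVU_continuity V w u r).
    - apply (CVU_of_bound _ _ (fun n => e (n + N)%nat)); assumption.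
    - intros n y Hy; apply trajectory_continuity with k, HV, Hy. }
  apply is_derive_Reals.
  apply (derivable_pt_lim_CVU V (fun n y => / V n y + INR (2 * k + 2) * y ^ (2 * k + 1)) w
    (fun y => / w y + INR (2 * k + 2) * y ^ (2 * k + 1)) u u r).
  + unfold Boule; rewrite Rminus_diag, Rabs_R0; apply cond_pos.
  + intros y n Hy; apply is_derive_Reals, HV, Hy.
  + intros y Hy; apply is_lim_seq_Reals.
    apply (is_lim_seq_incr_n (fun n => W n y) N), (Hlim N y (HB y Hy)).
  + apply (CVU_of_bound _ _ (fun n => / d ^ 2 * e (n + N)%nat)).
    * evar_last; [apply is_lim_seq_scal_l, HeN | simpl; f_equal; ring].
    * intros n y Hy.
      (* Both values are at least [d], so the caps are inactive and only supply the Lipschitz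
         bound. *)
      replace (/ V n y + INR (2 * k + 2) * y ^ (2 * k + 1)
               - (/ w y + INR (2 * k + 2) * y ^ (2 * k + 1)))
        with (/ Rmax (V n y) d - / Rmax (w y) d).
      -- eapply Rle_trans; [apply Rinv_Rmax_lipschitz, d0 | ].
         apply Rmult_le_compat_l; [ | apply HVw, Hy].
         left; apply Rinv_0_lt_compat; nra.
      -- rewrite !Rmax_left; [ring | apply Hwd, HB, Hy | apply Hd; [lia | apply HB, Hy]].
  + intros y Hy; apply (continuity_pt_plus (fun y => / w y) (fun y => INR (2 * k + 2) * y ^ (2 * k + 1))).
    * apply (continuity_pt_inv w); [apply Hcw, Hy | specialize (Hwd y (HB y Hy)); lra].
    * apply continuity_pt_filterlim.
      apply (ex_derive_continuous (V := R_NormedModule) (fun y => INR (2 * k + 2) * y ^ (2 * k + 1))).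
      auto_derive; exact I.
- intros u Hu; destruct (Ha u) as [N [_ HaN]].
  destruct (Hlim N u ltac:(lra)) as [Hl _].
  split.
  + apply (is_lim_seq_le_loc (fun _ => lower k u) (fun n => W n u) (lower k u) (w u));
      [ | apply is_lim_seq_const | exact Hl].
    exists N; intros n Hn; specialize (amono N n Hn); apply HWge; lra.
  + apply (is_lim_seq_le_loc (fun n => W n u) (fun _ => critical k u) (w u) (critical k u));
      [ | exact Hl | apply is_lim_seq_const].
    exists N; intros n Hn; specialize (amono N n Hn); apply HWle; lra.
Qed.

(** * Uniqueness and positivity *)

Lemma trajectory_unique (k : nat) (b : Rbar) (w1 w2 : R -> R) (M C : R) :
  (forall u : R, Rbar_lt u b -> trajectory k w1 u) ->
  (forall u : R, Rbar_lt u b -> trajectory k w2 u) ->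
  (forall u, u < M -> Rabs (w1 u - w2 u) <= C / u ^ (6 * k + 4)) ->
  forall u : R, Rbar_lt u b -> w1 u = w2 u.
Proof.
intros H1 H2 HC u Hu.
destruct (Req_dec (w1 u - w2 u) 0) as [E | E]; [lra | exfalso].
assert (e0 : 0 < Rabs (w1 u - w2 u)) by (apply Rabs_pos_lt, E).
set (e := Rabs (w1 u - w2 u)) in *.
assert (D0 : 0 <= Rabs C / e) by (apply Rdiv_le_0_compat; [apply Rabs_pos | exact e0]).
(* The point [- s] lies left of [u] and [M], and [s > Rabs C / e]. Contraction from [- s] to [u]
   gives [e <= C / s ^ (6 * k + 4)], hence [e * s <= Rabs C], which this choice contradicts. *)
set (s := 1 + Rabs u + Rabs M + Rabs C / e).
assert (Hus : - s <= u /\ - s < M).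
{ unfold s; pose proof (Rle_abs (- u)); pose proof (Rle_abs (- M)).
  rewrite Rabs_Ropp in *; pose proof (Rabs_pos u); pose proof (Rabs_pos M); lra. }
assert (s1 : 1 <= s) by (unfold s; pose proof (Rabs_pos u); pose proof (Rabs_pos M); lra).
assert (Hle : e <= C / (- s) ^ (6 * k + 4)).
{ eapply Rle_trans; [ | apply HC; lra].
  apply (trajectory_contraction k w1 w2 (- s) u); [lra | | ];
    intros t Ht; [apply H1 | apply H2]; apply Rbar_le_lt_trans with u; try assumption; simpl; lra. }
assert (Hs : (- s) ^ (6 * k + 4) = s ^ (6 * k + 4)).
{ replace (6 * k + 4)%nat with (2 * (3 * k + 2))%nat by lia.
  rewrite !pow_mult; f_equal; ring. }
assert (Hs1 : s <= s ^ (6 * k + 4)).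
{ replace (6 * k + 4)%nat with (S (6 * k + 3)) by lia; rewrite <- tech_pow_Rmult.
  pose proof (pow_R1_Rle s (6 * k + 3) s1); nra. }
rewrite Hs in Hle.
assert (HeC : e * s ^ (6 * k + 4) <= C).
{ apply (Rmult_le_compat_r (s ^ (6 * k + 4))) in Hle; [ | lra].
  unfold Rdiv in Hle; rewrite Rmult_assoc, Rinv_l in Hle; lra. }
assert (e * s <= Rabs C).
{ pose proof (Rle_abs C).
  apply Rle_trans with (e * s ^ (6 * k + 4)); [apply Rmult_le_compat_l | ]; lra. }
assert (Rabs C < e * s); [ | lra].
replace (Rabs C) with (e * (Rabs C / e)) by (field; lra).
apply Rmult_lt_compat_l; [exact e0 | ].
unfold s; pose proof (Rabs_pos u); pose proof (Rabs_pos M); lra.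
Qed.

(** By the intermediate value theorem, a nonvanishing continuous function keeps the sign it has far
    to the left. This upgrades the nonvanishing in [solution_on] to the positivity in
    [trajectory]. *)
Lemma nonzero_positive (w : R -> R) (b : Rbar) :
  (forall u : R, Rbar_lt u b -> w u <> 0 /\ continuity_pt w u) ->
  (exists M, forall u, u < M -> 0 < w u) ->
  forall u : R, Rbar_lt u b -> 0 < w u.
Proof.
intros Hw [M HM] u Hu.
destruct (Rtotal_order (w u) 0) as [H | [H | H]]; [exfalso | | exact H].
- set (v := - (Rabs u + Rabs M + 1)).
  assert (Hv : v < u /\ v < M).
  { unfold v; pose proof (Rle_abs (- u)); pose proof (Rle_abs (- M)).
    rewrite Rabs_Ropp in *; pose proof (Rabs_pos u); pose proof (Rabs_pos M); lra. }
  assert (Hb : forall t, v <= t <= u -> Rbar_lt t b).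
  { intros t Ht; apply Rbar_le_lt_trans with u; [simpl; lra | exact Hu]. }
  destruct (IVT_interv (fun t => - w t) v u) as [z [Hz Ez]].
  + intros t Ht; apply continuity_pt_opp, Hw, Hb, Ht.
  + lra.
  + specialize (HM v); lra.
  + lra.
  + apply (proj1 (Hw z (Hb z Hz))); lra.
- exfalso; apply (proj1 (Hw u Hu)), H.
Qed.

Lemma is_derive_trajectory_shift (k : nat) (eta : R -> R) (u l : R) :
  is_derive eta u l ->
  is_derive (fun v => eta v + v ^ (2 * k + 2)) u (l + INR (2 * k + 2) * u ^ (2 * k + 1)).
Proof.
intros H; apply (is_derive_plus (V := R_NormedModule)); [exact H | ].
auto_derive; [exact I | ].
change (k + (k + 0))%nat with (2 * k)%nat.
replace (pred (2 * k + 2)) with (2 * k + 1)%nat by lia; ring.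
Qed.

(** * Existence, expansion, uniqueness and bounds for the original equation *)

Theorem proposition3p10 (p : nat) (hp : (2 <= p)%nat) (hpe : Nat.Even p) :
  exists (b : Rbar) (eta0 : R -> R),
    Rbar_le 0 b /\
    solution_on p b eta0 /\
    has_expansion p eta0 /\
    (forall (b' : Rbar) (eta : R -> R),
        solution_on p b' eta -> has_expansion p eta ->
        Rbar_le b' b /\ forall u : R, Rbar_lt u b' -> eta u = eta0 u) /\
    exists K : R,
      K > 1 / INR p /\
      forall u : R, u < 0 ->
        - u ^ p < eta0 u /\ eta0 u < - u ^ p - K / u ^ (p - 1).
Proof.
destruct hpe as [k' ->].
destruct k' as [ | k]; [lia | ].
replace (2 * S k)%nat with (2 * k + 2)%nat by lia; clear hp.
unfold has_expansion.
replace (2 * k + 2 - 1)%nat with (2 * k + 1)%nat by lia.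
replace (3 * (2 * k + 2) - 2)%nat with (6 * k + 4)%nat by lia.
assert (HN : 2 <= INR (2 * k + 2)) by (apply (le_INR 2); lia).
(* The expansion reads [- u ^ p + critical k u], so its remainder is the distance of [eta + u ^ p]
   from [critical]. *)
assert (Hexp : forall (eta : R -> R) u, u < 0 ->
  eta u - (- u ^ (2 * k + 2) - 1 / INR (2 * k + 2) * (1 / u ^ (2 * k + 1)))
  = eta u + u ^ (2 * k + 2) - critical k u).
{ intros eta u Hu; unfold critical; pose proof (pow_odd_neg k u Hu); field; lra. }
assert (Habs : forall u, u < 0 -> Rabs (1 / u ^ (6 * k + 4)) = / u ^ (6 * k + 4)).
{ intros u Hu; pose proof (pow_6k4_pos k u ltac:(lra)).
  rewrite Rdiv_1_l; apply Rabs_pos_eq; left; apply Rinv_0_lt_compat; assumption. }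
destruct (slow_trajectory k) as [w [Hw Hb]].
exists p_infty, (fun u => w u - u ^ (2 * k + 2)).
split; [exact I | split; [ | split; [ | split]]].
- intros u _; destruct (Hw u) as [w0 D].
  replace (w u - u ^ (2 * k + 2) + u ^ (2 * k + 2)) with (w u) by ring.
  split; [lra | ].
  evar_last.
  + apply (is_derive_minus (V := R_NormedModule)); [exact D | ].
    apply (is_derive_pow (fun v => v) (2 * k + 2) u 1), (@is_derive_id R_AbsRing).
  + replace (pred (2 * k + 2)) with (2 * k + 1)%nat by lia.
    unfold minus, plus, opp; simpl; field; lra.
(* The trapping between [lower] and [critical] holds for all [u < 0] and gives the error term with
   constant 1. *)
- exists 1, 0; intros u Hu.
  rewrite (Hexp (fun u => w u - u ^ (2 * k + 2)) u Hu), Habs by exact Hu.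
  specialize (Hb u Hu); unfold lower in Hb.
  pose proof (pow_6k4_pos k u ltac:(lra)) as Hp; apply Rinv_0_lt_compat in Hp.
  apply Rabs_le; lra.
- intros b' eta Hsol [C [M HC]].
  split; [destruct b'; exact I | ].
  set (v u := eta u + u ^ (2 * k + 2)).
  assert (HvC : forall u, u < 0 -> u < M ->
    Rabs (v u - critical k u) <= C * / u ^ (6 * k + 4)).
  { intros u Hu HuM; rewrite <- Habs by exact Hu.
    unfold v; rewrite <- Hexp by exact Hu; apply HC, HuM. }
  assert (Dv : forall u : R, Rbar_lt u b' ->
    is_derive v u (/ v u + INR (2 * k + 2) * u ^ (2 * k + 1))).
  { intros u Hu; apply is_derive_trajectory_shift.
    rewrite <- Rdiv_1_l; apply (Hsol u Hu). }
  assert (Hv : forall u : R, Rbar_lt u b' -> trajectory k v u).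
  { intros u Hu; split; [ | apply Dv, Hu].
    revert u Hu; apply nonzero_positive.
    - intros u Hu; split; [apply (Hsol u Hu) | ].
      apply continuity_pt_filterlim, (ex_derive_continuous (V := R_NormedModule)).
      eexists; apply Dv, Hu.
    (* Left of this point [u < M], [1 <= - u] and [C * INR (2 * k + 2) < - u], so the correction is
       smaller than [critical]. *)
    - exists (- (1 + Rabs M + Rabs (C * INR (2 * k + 2)))); intros u Hu.
      pose proof (Rabs_pos M); pose proof (Rabs_pos (C * INR (2 * k + 2))).
      pose proof (Rle_abs (- M)); pose proof (Rle_abs (C * INR (2 * k + 2))).
      rewrite Rabs_Ropp in *.
      pose proof (HvC u ltac:(lra) ltac:(lra)) as H3.
      pose proof (correction_lt_critical k C u ltac:(lra) ltac:(lra)).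
      apply Rabs_le_between in H3; lra. }
  intros u Hu.
  enough (v u = w u) by (unfold v in *; lra).
  (* [C + 1] adds the distances of [v] and of [w] from [critical]. *)
  apply (trajectory_unique k b' v w (Rmin M 0) (C + 1) Hv (fun t _ => Hw t)); [ | exact Hu].
  intros t Ht.
  assert (t < 0 /\ t < M) as [t0 tM]
    by (pose proof (Rmin_l M 0); pose proof (Rmin_r M 0); lra).
  specialize (HvC t t0 tM); specialize (Hb t t0); unfold lower in Hb.
  pose proof (pow_6k4_pos k t ltac:(lra)) as Hp; apply Rinv_0_lt_compat in Hp.
  apply Rabs_le_between in HvC; unfold Rdiv; apply Rabs_le; lra.
(* Since [p >= 2], [1 > 1/p], and for the same reason [critical] lies strictly below
   [- 1 / u ^ (p - 1)]. *)
- exists 1; split.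
  + apply Rlt_gt, Rlt_div_l; lra.
  + intros u Hu; destruct (Hw u) as [w0 _].
    pose proof (pow_odd_neg k u Hu) as Hq.
    assert (critical k u < - (1 / u ^ (2 * k + 1))).
    { unfold critical; rewrite Rdiv_1_l, <- !Rinv_opp; apply Rinv_lt_contravar; nra. }
    specialize (Hb u Hu); lra.
Qed.
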